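(* Let $\mathcal{F}_1:\mathbf{Hyperfields}_{dd}\to\mathbf{PartialDemifields}$ be the functor $F\mapsto(F,S(F))$. The functor $\overline{\mathcal{F}}:\mathbf{Hyperfields}_{dd}\to\mathbf{FuzzyRings}_{str}$ admits a factorization $\overline{\mathcal{F}}=\mathcal{F}_2\circ\mathcal{F}_1$ for a functor $\mathcal{F}_2:\mathrm{Im}(\mathcal{F}_1)\to\mathbf{FuzzyRings}_{str}$. The functor $\mathcal{F}_1$ is neither full nor essentially surjective.
   Context: **Hyperfields.** For a set $A$, $\mathcal{P}^*(A)$ is the set of nonempty subsets of $A$. A hyperoperation on $A$ is a map $+:A\times A\to\mathcal{P}^*(A)$; it extends to $\mathcal{P}^*(A)$ by $X+Y=\bigcup_{x\in X,y\in Y}(x+y)$ (elements are identified with singletons). A canonical hypergroup is a set $A$ with a hyperoperation $+$ such that: $a+b=b+a$; there is an element $0$ with $a+0=\{a\}$ for all $a$; for each $a$ there is a unique $-a\in A$ with $0\in a+(-a)$; $(a+b)+c=a+(b+c)$; and $a\in b+c$ if and only if $c\in a+(-b)$. A hyperring is a set $R$ with a multiplication $\times$ and a hyperoperation $+$ such that $(R,+)$ is a canonical hypergroup, $(R,\times)$ is a unital commutative monoid, $a(b+c)=ab+ac$, and $a\times 0=0$. A hyperfield is a hyperring in which $(R\smallsetminus\{0\},\times)$ is a group. It is doubly-distributive if $(a+b)(c+d)=ac+ad+bc+bd$ for all $a,b,c,d$ (where $XY=\{xy\mid x\in X,y\in Y\}$). A homomorphism is a map $f$ with $f(0)=0$,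 $f(1)=1$, $f(ab)=f(a)f(b)$ and $f(a+b)\subseteq f(a)+f(b)$; it is strict if this containment is always an equality. $\mathbf{Hyperfields}_{dd}$ is the category of doubly-distributive hyperfields and strict homomorphisms. **Fuzzy rings.** A fuzzy ring is a tuple $(K;+,\times;\varepsilon,K_0)$ with $K$ a set, $+,\times$ binary operations on $K$, $\varepsilon\in K$, $K_0\subset K$, such that, with $K^\times$ the group of multiplicative units: (FR0) $(K,+)$ and $(K,\times)$ are commutative monoids with neutral elements $0$ and $1$; (FR1) $0\times a=0$ for all $a\in K$; (FR2) $a(b+c)=ab+ac$ for all $b,c\in K$, $a\in K^\times$; (FR3) $\varepsilon^2=1$; (FR4) $K_0+K_0\subseteq K_0$, $K\times K_0\subseteq K_0$, $0\in K_0$, $1\notin K_0$; (FR5) for $a\in K^\times$, $1+a\in K_0$ if and only if $a=\varepsilon$; (FR6) if $a+b\in K_0$ and $c+d\in K_0$ then $ac+\varepsilon bd\in K_0$; (FR7) if $a+b(c+d)\in K_0$ then $a+bc+bd\in K_0$. A strong morphism $K\to L$ is a map $f:K\to L$ with $f(1)=1$, $f(0)=0$, $f(a\times b)=f(a)\times f(b)$ for all $a\in K^\times$, $b\in K$, and such that for all $a_i,b_i\in K$, if $\sum_{i=1}^n a_i\times b_i\in K_0$ then $\sum_{i=1}^n f(a_i)\times f(b_i)\in L_0$. $\mathbf{FuzzyRings}_{str}$ is the category of fuzzy rings and strong morphisms. **$S(F)$ and $\overline{\mathcal{F}}$.** For a doubly-distributive hyperfield $F$, let $S(F)$ be the set of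 all subsets of $F$ of the form $\sum_{i=1}^n a_i$ (finite hypersums, $a_i\in F$, $n\ge1$), with $A+B=\bigcup_{a\in A,b\in B}(a+b)$ and $A\times B=\{ab\mid a\in A,b\in B\}$; it is a semiring. $\overline{\mathcal{F}}(F)$ is the fuzzy ring $(S(F);+,\times;\varepsilon,K_0)$ with $\varepsilon=\{-1_F\}$, $0=\{0_F\}$, $1=\{1_F\}$, $K_0=\{A\in S(F)\mid 0_F\in A\}$. For a strict homomorphism $f$, $\overline{\mathcal{F}}(f)$ is $A\mapsto f(A)$. **Partial demifields.** A partial demifield is a pair $(F,S)$ of a semiring $(S,+_S,\times_S)$ and a hyperfield $(F,+_F,\times_F)$ such that (1) $F$ is a submonoid of $S$ with respect to multiplication and the smallest subsemiring of $S$ containing $F$ is $S$; (2) for $a,b\in F$, if $a+_Sb\in F$ then $a+_Sb\in a+_Fb$. A morphism $(F,S)\to(F',S')$ is a semiring homomorphism $S\to S'$ that restricts to a hyperfield homomorphism $F\to F'$. $\mathbf{PartialDemifields}$ is the resulting category. **$\mathcal{F}_1$.** $\mathcal{F}_1(F)=(F,S(F))$, where $F$ is identified with the singletons in $S(F)$, and $\mathcal{F}_1(f)$ is the semiring homomorphism $S(F)\to S(F')$, $A\mapsto f(A)$. $\mathrm{Im}(\mathcal{F}_1)$ denotes the essential image of $\mathcal{F}_1$, i.e. the full subcategory of $\mathbf{PartialDemifields}$ on objects isomorphic to some $\mathcal{F}_1(F)$. *)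

(* Defs.v *)
From HB Require Import structures.
From mathcomp Require Import all_boot ssralg.
From mathcomp Require Import boolp classical_sets functions.

Set Implicit Arguments.
Unset Strict Implicit.
Unset Printing Implicit Defensive.

Import GRing.Theory.

Local Open Scope classical_set_scope.
Local Open Scope ring_scope.

Record Category := MkCategory {
  Ob :> Type;
  Hom : Ob -> Ob -> Type;
  idm : forall X, Hom X X;
  comp : forall X Y Z, Hom Y Z -> Hom X Y -> Hom X Z;
  compA : forall X Y Z W (h : Hom Z W) (g : Hom Y Z) (f : Hom X Y),
    comp h (comp g f) = comp (comp h g) f;
  comp1m : forall X Y (f : Hom X Y), comp (idm Y) f = f;
  compm1 : forall X Y (f : Hom X Y), comp f (idm X) = f
}.
Arguments Hom {_} _ _.
Arguments idm {_} _.
Arguments comp {_ _ _ _} _ _.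

Record Functor (C D : Category) := MkFunctor {
  fob :> C -> D;
  fmap : forall X Y : C, Hom X Y -> Hom (fob X) (fob Y);
  fmap1 : forall X : C, fmap (idm X) = idm (fob X);
  fmapM : forall (X Y Z : C) (g : Hom Y Z) (f : Hom X Y),
    fmap (comp g f) = comp (fmap g) (fmap f)
}.
Arguments fmap {_ _} _ {_ _} _.

Lemma fcomp_fmap1 C D E (G : Functor D E) (F : Functor C D) (X : C) :
  fmap G (fmap F (idm X)) = idm (G (F X)).
Proof. by rewrite !fmap1. Qed.

Lemma fcomp_fmapM C D E (G : Functor D E) (F : Functor C D)
    (X Y Z : C) (g : Hom Y Z) (f : Hom X Y) :
  fmap G (fmap F (comp g f)) = comp (fmap G (fmap F g)) (fmap G (fmap F f)).
Proof. by rewrite !fmapM. Qed.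

Definition fcomp C D E (G : Functor D E) (F : Functor C D) : Functor C E :=
  @MkFunctor C E (fun X => G (F X)) (fun X Y f => fmap G (fmap F f))
    (fcomp_fmap1 G F) (fcomp_fmapM G F).

Definition isomorphic (C : Category) (X Y : C) : Prop :=
  exists (f : Hom X Y) (g : Hom Y X), comp g f = idm X /\ comp f g = idm Y.

Lemma isomorphic_refl (C : Category) (X : C) : isomorphic X X.
Proof. by exists (idm X), (idm X); rewrite comp1m. Qed.

Definition full_subcategory (C : Category) (P : C -> Prop) : Category :=
  @MkCategory {X : C | P X} (fun X Y => Hom (sval X) (sval Y))
    (fun X => idm (sval X)) (fun X Y Z g f => comp g f)
    (fun X Y Z W h g f => compA h g f)
    (fun X Y f => comp1m f) (fun X Y f => compm1 f).

Definition ess_image C D (F : Functor C D) : Category :=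
  full_subcategory (fun Y : D => exists X : C, isomorphic (F X) Y).

Definition corestrict C D (F : Functor C D) : Functor C (ess_image F) :=
  @MkFunctor C (ess_image F)
    (fun X => exist _ (F X) (ex_intro _ X (isomorphic_refl (F X))))
    (fun X Y f => fmap F f) (fmap1 F) (fun X Y Z g f => fmapM F g f).

Definition full C D (F : Functor C D) : Prop :=
  forall (X Y : C) (g : Hom (F X) (F Y)), exists f : Hom X Y, fmap F f = g.

Definition ess_surjective C D (F : Functor C D) : Prop :=
  forall Y : D, exists X : C, isomorphic (F X) Y.

Definition hyperop_set A (add : A -> A -> set A) (X Y : set A) : set A :=
  \bigcup_(x in X) \bigcup_(y in Y) add x y.

Definition mul_set A (mul : A -> A -> A) (X Y : set A) : set A :=
  [set mul x y | x in X & y in Y].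

Record canonical_hypergroup A (add : A -> A -> set A) (zero : A)
    (neg : A -> A) : Prop := CanonicalHypergroup {
  chg_neq0 : forall a b, add a b !=set0;
  chgC : forall a b, add a b = add b a;
  chg0 : forall a, add a zero = [set a];
  (* [neg a] is the unique element whose hypersum with [a] contains zero. *)
  chgN : forall a b, add a b zero <-> b = neg a;
  chgA : forall a b c,
    hyperop_set add (add a b) [set c] = hyperop_set add [set a] (add b c);
  chg_rev : forall a b c, add b c a <-> add a (neg b) c
}.

Record is_hyperring R (add : R -> R -> set R) (mul : R -> R -> R)
    (zero one : R) (neg : R -> R) : Prop := IsHyperring {
  hr_chg : canonical_hypergroup add zero neg;
  hr_mulA : associative mul;
  hr_mulC : commutative mul;
  hr_mul1 : right_id one mul;
  hr_mulD : forall a b c, mul a @` (add b c) = add (mul a b) (mul a c);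
  hr_mul0 : right_zero zero mul
}.

Record Hyperfield := MkHyperfield {
  hf_sort :> Type;
  hadd : hf_sort -> hf_sort -> set hf_sort;
  hmul : hf_sort -> hf_sort -> hf_sort;
  hzero : hf_sort;
  hone : hf_sort;
  hneg : hf_sort -> hf_sort;
  hf_hyperring : is_hyperring hadd hmul hzero hone hneg;
  (* the nonzero elements form a group under multiplication *)
  hf_one_neq0 : hone <> hzero;
  hf_inv : forall a, a <> hzero -> exists b, hmul a b = hone
}.
Arguments hadd {_} _ _.
Arguments hmul {_} _ _.
Arguments hzero {_}.
Arguments hone {_}.
Arguments hneg {_} _.

Declare Scope hyper_scope.
Delimit Scope hyper_scope with H.
Notation "0" := hzero : hyper_scope.
Notation "1" := hone : hyper_scope.
Notation "- a" := (hneg a) : hyper_scope.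
Notation "a * b" := (hmul a b) : hyper_scope.
Notation "a ⊞ b" := (hadd a b) (at level 50, left associativity) : hyper_scope.
Notation "A ⊕ B" := (hyperop_set hadd A B)
  (at level 50, left associativity) : hyper_scope.
Notation "A ⊗ B" := (mul_set hmul A B)
  (at level 40, left associativity) : hyper_scope.
Local Open Scope hyper_scope.

Definition doubly_distributive (F : Hyperfield) : Prop :=
  forall a b c d : F,
    (a ⊞ b) ⊗ (c ⊞ d) =
      (a * c) ⊞ (a * d) ⊕ [set b * c] ⊕ [set b * d].

Record ddHyperfield := DDHyperfield {
  dd_field :> Hyperfield;
  dd_distr : doubly_distributive dd_field
}.

Record is_hyperhom (F G : Hyperfield) (f : F -> G) : Prop := IsHyperhom {
  hhom0 : f 0 = 0;
  hhom1 : f 1 = 1;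
  hhomM : forall a b, f (a * b) = f a * f b;
  hhomD : forall a b, f @` (a ⊞ b) `<=` f a ⊞ f b
}.

Record strict_hom (F G : Hyperfield) := StrictHom {
  shom_fun :> F -> G;
  shom_hom : is_hyperhom shom_fun;
  shomD : forall a b, shom_fun @` (a ⊞ b) = shom_fun a ⊞ shom_fun b
}.

Lemma strict_hom_eq F G (f g : strict_hom F G) : f =1 g -> f = g.
Proof.
case: f g => [f f1 f2] [g g1 g2] /= /funext fg; subst g.
by rewrite (Prop_irrelevance f1 g1) (Prop_irrelevance f2 g2).
Qed.

Lemma id_is_hyperhom (F : Hyperfield) : is_hyperhom (@id F).
Proof. by split => // a b; rewrite image_id. Qed.

Lemma comp_is_hyperhom (F G H : Hyperfield) (g : G -> H) (f : F -> G) :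
  is_hyperhom g -> is_hyperhom f -> is_hyperhom (g \o f).
Proof.
move=> [g0 g1 gM gD] [f0 f1 fM fD]; split => /=.
- by rewrite f0.
- by rewrite f1.
- by move=> a b; rewrite fM gM.
- move=> a b _ [x xab <-]; apply: gD; exists (f x) => //.
  by apply: fD; exists x.
Qed.

Definition strict_id (F : Hyperfield) : strict_hom F F :=
  StrictHom (id_is_hyperhom F) (fun a b => image_id (a ⊞ b)).

Lemma strict_compD F G H (g : strict_hom G H) (f : strict_hom F G) a b :
  (g \o f) @` (a ⊞ b) = (g \o f) a ⊞ (g \o f) b.
Proof. by rewrite -image_comp !shomD. Qed.

Definition strict_comp F G H (g : strict_hom G H) (f : strict_hom F G) :
    strict_hom F H :=
  StrictHom (comp_is_hyperhom (shom_hom g) (shom_hom f)) (strict_compD g f).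

Definition Hyperfields_dd : Category.
Proof.
by refine (@MkCategory ddHyperfield (fun F G => strict_hom F G)
  (fun F => strict_id F) (fun F G H => @strict_comp F G H) _ _ _) => *;
  apply: strict_hom_eq.
Defined.

Definition mul_unit K (mul : K -> K -> K) (one : K) (a : K) : Prop :=
  exists b, mul a b = one.

Record is_fuzzy_ring (K : nmodType) (mul : K -> K -> K) (one eps : K)
    (K0 : set K) : Prop := IsFuzzyRing {
  (* the commutative monoid (K, +) is the [nmodType] structure *)
  fr0_mulA : associative mul;
  fr0_mulC : commutative mul;
  fr0_mul1 : left_id one mul;
  fr1 : forall a, mul 0%R a = 0%R;
  fr2 : forall a b c, mul_unit mul one a ->
    mul a (b + c) = mul a b + mul a c;
  fr3 : mul eps eps = one;
  fr4_add : forall a b, K0 a -> K0 b -> K0 (a + b);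
  fr4_mul : forall a b, K0 b -> K0 (mul a b);
  fr4_0 : K0 0%R;
  fr4_1 : ~ K0 one;
  fr5 : forall a, mul_unit mul one a -> (K0 (one + a) <-> a = eps);
  fr6 : forall a b c d, K0 (a + b) -> K0 (c + d) ->
    K0 (mul a c + mul eps (mul b d));
  fr7 : forall a b c d, K0 (a + mul b (c + d)) ->
    K0 (a + mul b c + mul b d)
}.

Record FuzzyRing := MkFuzzyRing {
  fr_sort :> nmodType;
  fr_mul : fr_sort -> fr_sort -> fr_sort;
  fr_one : fr_sort;
  fr_eps : fr_sort;
  fr_null : set fr_sort;
  fr_axioms : is_fuzzy_ring fr_mul fr_one fr_eps fr_null
}.
Arguments fr_mul {_} _ _.
Arguments fr_one {_}.
Arguments fr_eps {_}.
Arguments fr_null {_} _.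

Record is_strong_morphism (K L : FuzzyRing) (f : K -> L) : Prop :=
  IsStrongMorphism {
  strong1 : f fr_one = fr_one;
  strong0 : f 0%R = 0%R;
  strongM : forall a b, mul_unit fr_mul fr_one a ->
    f (fr_mul a b) = fr_mul (f a) (f b);
  strong_null : forall n (a b : 'I_n -> K),
    fr_null (\sum_(i < n) fr_mul (a i) (b i)) ->
    fr_null (\sum_(i < n) fr_mul (f (a i)) (f (b i)))
}.

Record strong_morphism (K L : FuzzyRing) := StrongMorphism {
  strong_fun :> K -> L;
  strong_ax : is_strong_morphism strong_fun
}.

Lemma strong_morphism_eq K L (f g : strong_morphism K L) : f =1 g -> f = g.
Proof.
case: f g => [f f1] [g g1] /= /funext fg; subst g.
by rewrite (Prop_irrelevance f1 g1).
Qed.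

Lemma id_is_strong (K : FuzzyRing) : is_strong_morphism (@id K).
Proof. by []. Qed.

Lemma comp_is_strong (K L M : FuzzyRing) (g : strong_morphism L M)
  (f : strong_morphism K L) : is_strong_morphism (g \o f).
Proof.
case: f g => [f [f1 f0 fM fN]] [g [g1 g0 gM gN]]; split => /=.
- by rewrite f1.
- by rewrite f0.
- move=> a b ua; rewrite fM // gM //.
  by have [a' aa'] := ua; exists (f a'); rewrite -fM // aa'.
- by move=> n a b /fN /gN.
Qed.

Definition FuzzyRings_str : Category.
Proof.
by refine (@MkCategory FuzzyRing strong_morphism
  (fun K => StrongMorphism (id_is_strong K))
  (fun K L M g f => StrongMorphism (comp_is_strong g f)) _ _ _) => *;
  apply: strong_morphism_eq.
Defined.

(* [F] is regarded as a subset of [S] along the injection [incl].  The semiring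
   need not be assumed commutative: it is generated by the commutative [F]. *)
Record is_partial_demifield (F : Hyperfield) (S : pzSemiRingType)
    (incl : F -> S) : Prop := IsPartialDemifield {
  pd_inj : injective incl;
  pd_incl1 : incl 1 = 1%R;
  pd_inclM : forall a b, incl (a * b) = (incl a * incl b)%R;
  pd_gen : forall T : {pred S}, semiring_closed T ->
    (forall a, incl a \in T) -> forall x, x \in T;
  pd_add : forall a b c : F, incl a + incl b = incl c -> (a ⊞ b) c
}.

Record PartialDemifield := MkPartialDemifield {
  pd_field : Hyperfield;
  pd_semiring : pzSemiRingType;
  pd_incl : pd_field -> pd_semiring;
  pd_axioms : is_partial_demifield pd_incl
}.

Record pd_morphism (P Q : PartialDemifield) := PDMorphism {
  pdm_fun :> pd_semiring P -> pd_semiring Q;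
  pdm_add : nmod_morphism pdm_fun;
  pdm_mul : monoid_morphism pdm_fun;
  pdm_restr : exists2 g : pd_field P -> pd_field Q,
    is_hyperhom g & forall a, pdm_fun (pd_incl a) = pd_incl (g a)
}.

Lemma pd_morphism_eq P Q (f g : pd_morphism P Q) : f =1 g -> f = g.
Proof.
case: f g => [f f1 f2 f3] [g g1 g2 g3] /= /funext fg; subst g.
by rewrite (Prop_irrelevance f1 g1) (Prop_irrelevance f2 g2)
  (Prop_irrelevance f3 g3).
Qed.

Definition pd_id (P : PartialDemifield) : pd_morphism P P.
Proof.
refine (@PDMorphism P P id _ _ _); [by [] | by [] |].
by exists id => //; exact: id_is_hyperhom.
Defined.

Definition pd_comp (P Q R : PartialDemifield) (g : pd_morphism Q R)
  (f : pd_morphism P Q) : pd_morphism P R.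
Proof.
refine (@PDMorphism P R (g \o f) _ _ _).
- case: f g => f [f0 fD] _ _ [g [g0 gD] _ _] /=.
  by split=> [|x y] /=; rewrite ?f0 // fD gD.
- case: f g => f _ [f1 fM] _ [g _ [g1 gM] _] /=.
  by split=> [|x y] /=; rewrite ?f1 // fM gM.
- have [h hh hE] := pdm_restr f; have [k kh kE] := pdm_restr g.
  exists (k \o h); first exact: comp_is_hyperhom.
  by move=> a /=; rewrite hE kE.
Defined.

Definition PartialDemifields : Category.
Proof.
by refine (@MkCategory PartialDemifield pd_morphism pd_id pd_comp _ _ _) => *;
  apply: pd_morphism_eq.
Defined.

(* Starting from the neutral [set 0] does not change a nonempty hypersum. *)
Definition hypersum (F : Hyperfield) (s : seq F) : set F :=
  \big[hyperop_set hadd/[set 0]]_(a <- s) [set a].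

Definition is_hypersum (F : Hyperfield) (A : set F) : Prop :=
  exists2 s : seq F, (0 < size s)%N & A = hypersum s.

Section HyperfieldTheory.
Context {F : Hyperfield}.
Implicit Types (a b c x y z : F) (A B C X Y Z : set F) (s t : seq F).

Let chg := hr_chg (hf_hyperring F).

Lemma hmulA : associative (@hmul F).
Proof. exact: hr_mulA (hf_hyperring F). Qed.

Lemma hmulC : commutative (@hmul F).
Proof. exact: hr_mulC (hf_hyperring F). Qed.

Lemma hmulr1 : right_id 1 (@hmul F).
Proof. exact: hr_mul1 (hf_hyperring F). Qed.

Lemma hmulr0 : right_zero 0 (@hmul F).
Proof. exact: hr_mul0 (hf_hyperring F). Qed.

Lemma hmulDr a b c : hmul a @` (b ⊞ c) = (a * b) ⊞ (a * c).
Proof. exact: hr_mulD (hf_hyperring F) a b c. Qed.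

Lemma in_hadd_set X Y z :
  (X ⊕ Y) z <-> exists x y, [/\ X x, Y y & (x ⊞ y) z].
Proof.
split=> [[x Xx [y Yy xyz]]|[x [y [Xx Yy xyz]]]]; first by exists x, y.
by exists x => //; exists y.
Qed.

Lemma in_hmul_set X Y z :
  (X ⊗ Y) z <-> exists x y, [/\ X x, Y y & z = x * y].
Proof.
split=> [[x Xx [y Yy xyz]]|[x [y [Xx Yy ->]]]]; first by exists x, y.
by exists x => //; exists y.
Qed.

Lemma hadd_set11 a b : [set a] ⊕ [set b] = a ⊞ b.
Proof. by rewrite /hyperop_set !bigcup_set1. Qed.

Lemma hadd_setSS X Y X' Y' : X `<=` X' -> Y `<=` Y' -> X ⊕ Y `<=` X' ⊕ Y'.
Proof.
move=> XX' YY' w /in_hadd_set[u [v [Xu Yv uvw]]].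
by apply/in_hadd_set; exists u, v; split; [exact: XX' | exact: YY' |].
Qed.

Lemma hadd_setC : commutative (hyperop_set (@hadd F)).
Proof.
move=> X Y; apply/seteqP; split=> z /in_hadd_set[x [y [Xx Yy]]];
  by rewrite (chgC chg) => h; apply/in_hadd_set; exists y, x.
Qed.

Lemma hadd_set0 : left_id [set (0 : F)] (hyperop_set hadd).
Proof.
move=> X; rewrite hadd_setC; apply/seteqP; split=> z.
  by move=> /in_hadd_set[x [_ [Xx ->]]]; rewrite (chg0 chg) => ->.
by move=> Xz; apply/in_hadd_set; exists z, 0; split; rewrite ?(chg0 chg).
Qed.

Lemma hadd_setA_sub X Y Z : X ⊕ Y ⊕ Z `<=` X ⊕ (Y ⊕ Z).
Proof.
move=> w /in_hadd_set[u [z [/in_hadd_set[x [y [Xx Yy xyu]] Zz uzw]]]].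
have : ((x ⊞ y) ⊕ [set z]) w by apply/in_hadd_set; exists u, z.
rewrite (chgA chg) => /in_hadd_set[_ [v [-> yzv xvw]]].
apply/in_hadd_set; exists x, v; split=> //.
by apply/in_hadd_set; exists y, z.
Qed.

Lemma hadd_setA : associative (hyperop_set (@hadd F)).
Proof.
move=> X Y Z; apply/seteqP; split; last exact: hadd_setA_sub.
rewrite hadd_setC (hadd_setC Y) (hadd_setC _ Z) (hadd_setC X).
exact: hadd_setA_sub.
Qed.

HB.instance Definition _ := Monoid.isComLaw.Build (set F) [set (0 : F)]
  (hyperop_set hadd) hadd_setA hadd_setC hadd_set0.

Lemma hmul_setC : commutative (mul_set (@hmul F)).
Proof.
move=> X Y; apply/seteqP; split=> z /in_hmul_set[x [y [Xx Yy ->]]];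
  by rewrite hmulC; apply/in_hmul_set; exists y, x.
Qed.

Lemma hmul_setA : associative (mul_set (@hmul F)).
Proof.
move=> X Y Z; apply/seteqP; split=> w.
  move=> /in_hmul_set[x [u [Xx /in_hmul_set[y [z [Yy Zz ->]]] ->]]].
  rewrite hmulA; apply/in_hmul_set.
  by exists (x * y), z; split=> //; apply/in_hmul_set; exists x, y.
move=> /in_hmul_set[u [z [/in_hmul_set[x [y [Xx Yy ->]]] Zz ->]]].
rewrite -hmulA; apply/in_hmul_set.
by exists x, (y * z); split=> //; apply/in_hmul_set; exists y, z.
Qed.

Lemma hmul_set11 a b : [set a] ⊗ [set b] = [set a * b].
Proof.
apply/seteqP; split=> z; first by move=> /in_hmul_set[_ [_ [-> -> ->]]].
by move=> ->; apply/in_hmul_set; exists a, b.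
Qed.

Lemma hmul_set1 : left_id [set (1 : F)] (mul_set hmul).
Proof.
move=> X; rewrite hmul_setC; apply/seteqP; split=> z.
  by move=> /in_hmul_set[x [_ [Xx -> ->]]]; rewrite hmulr1.
move=> Xz; apply/in_hmul_set; exists z, 1; split=> //.
by rewrite hmulr1.
Qed.

Lemma hmul_set0 X : X !=set0 -> [set 0] ⊗ X = [set 0].
Proof.
move=> [x0 Xx0]; rewrite hmul_setC; apply/seteqP; split=> z.
  by move=> /in_hmul_set[x [_ [Xx -> ->]]]; rewrite hmulr0.
move=> ->; apply/in_hmul_set; exists x0, 0; split=> //.
by rewrite hmulr0.
Qed.

Lemma hmul_set1D a X Y :
  [set a] ⊗ (X ⊕ Y) = [set a] ⊗ X ⊕ [set a] ⊗ Y.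
Proof.
apply/seteqP; split=> w.
  move=> /in_hmul_set[_ [u [-> /in_hadd_set[x [y [Xx Yy xyu]]] ->]]].
  apply/in_hadd_set; exists (a * x), (a * y); split.
  - by apply/in_hmul_set; exists a, x.
  - by apply/in_hmul_set; exists a, y.
  - by rewrite -hmulDr; exists u.
move=> /in_hadd_set[p [q [/in_hmul_set[_ [x [-> Xx ->]]]]]].
move=> /in_hmul_set[_ [y [-> Yy ->]]].
rewrite -hmulDr => -[u xyu <-].
apply/in_hmul_set; exists a, u; split=> //.
by apply/in_hadd_set; exists x, y.
Qed.

Lemma hypersum_nil : hypersum [::] = [set (0 : F)].
Proof. exact: big_nil. Qed.

Lemma hypersum_cons a s : hypersum (a :: s) = [set a] ⊕ hypersum s.
Proof. exact: big_cons. Qed.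

Lemma hypersum_cat s t : hypersum (s ++ t) = hypersum s ⊕ hypersum t.
Proof. exact: big_cat. Qed.

Lemma is_hypersumE A : is_hypersum A <-> exists s, A = hypersum s.
Proof.
split=> [[s _ ->]|[s ->]]; first by exists s.
by exists (0 :: s) => //; rewrite hypersum_cons hadd_set0.
Qed.

Lemma is_hypersum1 a : is_hypersum [set a].
Proof.
apply/is_hypersumE; exists [:: a].
by rewrite hypersum_cons hypersum_nil hadd_setC hadd_set0.
Qed.

Lemma is_hypersumD A B : is_hypersum A -> is_hypersum B -> is_hypersum (A ⊕ B).
Proof.
move=> /is_hypersumE[s ->] /is_hypersumE[t ->].
by apply/is_hypersumE; exists (s ++ t); rewrite hypersum_cat.
Qed.

Lemma is_hypersum_neq0 A : is_hypersum A -> A !=set0.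
Proof.
move=> /is_hypersumE[s ->]; elim: s => [|a s [x sx]].
  by rewrite hypersum_nil; exists 0.
have [y axy] := chg_neq0 chg a x.
by rewrite hypersum_cons; exists y; apply/in_hadd_set; exists a, x.
Qed.

End HyperfieldTheory.

Section DDTheory.
Context {F : ddHyperfield}.
Implicit Types (a b c x y z : F) (A B C X Y Z : set F) (s t : seq F).

Lemma hadd_mul_hypersum x y s :
  (x ⊞ y) ⊗ hypersum s = [set x] ⊗ hypersum s ⊕ [set y] ⊗ hypersum s.
Proof.
elim: s => [|c s IH].
  rewrite hypersum_nil !hmul_set11 hmul_setC hmul_set0; last first.
    exact: chg_neq0 (hr_chg (hf_hyperring F)) _ _.
  by rewrite !hmulr0 hadd_set0.
rewrite hypersum_cons; set Z := hypersum s in IH *.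
have key d : (x ⊞ y) ⊗ ([set c] ⊕ [set d]) =
    [set x] ⊗ [set c] ⊕ [set y] ⊗ [set c] ⊕
      ([set x] ⊗ [set d] ⊕ [set y] ⊗ [set d]).
  rewrite hadd_set11 (dd_distr x y c d) -hadd_set11 !hmul_set11 hadd_setA.
  by rewrite -!hadd_setA; congr (_ ⊕ _); rewrite !hadd_setA;
     congr (_ ⊕ _); rewrite hadd_setC.
rewrite !hmul_set1D.
have -> : [set x] ⊗ [set c] ⊕ [set x] ⊗ Z ⊕ ([set y] ⊗ [set c] ⊕ [set y] ⊗ Z)
  = [set x] ⊗ [set c] ⊕ [set y] ⊗ [set c] ⊕ ([set x] ⊗ Z ⊕ [set y] ⊗ Z).
  rewrite -!hadd_setA; congr (_ ⊕ _); rewrite !hadd_setA; congr (_ ⊕ _).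
  by rewrite hadd_setC.
have subZ d X : Z d -> X ⊗ [set d] `<=` X ⊗ Z.
  move=> Zd w /in_hmul_set[u [_ [Xu -> ->]]].
  by apply/in_hmul_set; exists u, d.
apply/seteqP; split=> w.
  move=> /in_hmul_set[u [v [xyu /in_hadd_set[_ [d [-> Zd cdv]]] ->]]].
  have : ((x ⊞ y) ⊗ ([set c] ⊕ [set d])) (u * v).
    by apply/in_hmul_set; exists u, v; rewrite hadd_set11.
  by rewrite key; apply: hadd_setSS => //; apply: hadd_setSS; exact: subZ.
move=> /in_hadd_set[t [u [xyct]]]; rewrite -IH.
move=> /in_hmul_set[v [d [xyv Zd uE]]] tuw.
have : ((x ⊞ y) ⊗ ([set c] ⊕ [set d])) w.
  rewrite key; apply/in_hadd_set; exists t, u; split=> //.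
  have : ((x ⊞ y) ⊗ hypersum [:: d]) u.
    apply/in_hmul_set; exists v, d.
    by rewrite hypersum_cons hypersum_nil hadd_setC hadd_set0.
  move=> {}uE'; move: (uE').
  have -> : (x ⊞ y) ⊗ hypersum [:: d] =
      [set x] ⊗ [set d] ⊕ [set y] ⊗ [set d]; last by [].
  rewrite hypersum_cons hypersum_nil hadd_setC hadd_set0 !hmul_set11.
  rewrite hmul_setC -(hadd_set11 x y) hmul_set1D !hmul_set11.
  by rewrite !(hmulC d).
move=> /in_hmul_set[p [q [? cdq ->]]]; apply/in_hmul_set; exists p, q.
by split=> //; apply: hadd_setSS cdq => // _ ->.
Qed.

Lemma hmul_setDl A B C : is_hypersum C -> (A ⊕ B) ⊗ C = A ⊗ C ⊕ B ⊗ C.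
Proof.
move=> /is_hypersumE[s ->]; apply/seteqP; split=> w.
  move=> /in_hmul_set[u [z [/in_hadd_set[a [b [Aa Bb abu]]] sz ->]]].
  have : ((a ⊞ b) ⊗ hypersum s) (u * z) by apply/in_hmul_set; exists u, z.
  rewrite hadd_mul_hypersum => /in_hadd_set[p [q []]].
  move=> /in_hmul_set[_ [z1 [-> sz1 ->]]] /in_hmul_set[_ [z2 [-> sz2 ->]]] h.
  apply/in_hadd_set; exists (a * z1), (b * z2); split=> //.
    by apply/in_hmul_set; exists a, z1.
  by apply/in_hmul_set; exists b, z2.
move=> /in_hadd_set[p [q [/in_hmul_set[a [z1 [Aa sz1 ->]]]]]].
move=> /in_hmul_set[b [z2 [Bb sz2 ->]]] h.
have : ((a ⊞ b) ⊗ hypersum s) w.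
  rewrite hadd_mul_hypersum; apply/in_hadd_set; exists (a * z1), (b * z2).
  split=> //; apply/in_hmul_set; first by exists a, z1.
  by exists b, z2.
move=> /in_hmul_set[u [z [abu sz ->]]]; apply/in_hmul_set; exists u, z.
by split=> //; apply/in_hadd_set; exists a, b.
Qed.

Lemma is_hypersumM A B : is_hypersum A -> is_hypersum B -> is_hypersum (A ⊗ B).
Proof.
move=> /is_hypersumE[s ->] hB; elim: s => [|a s IH].
  rewrite hypersum_nil hmul_set0; last exact: is_hypersum_neq0.
  exact: is_hypersum1.
rewrite hypersum_cons hmul_setDl //; apply: is_hypersumD => //.
move: hB => /is_hypersumE[t ->]; elim: t {IH} => [|b t IH].
  by rewrite hypersum_nil hmul_set11; exact: is_hypersum1.
rewrite hypersum_cons hmul_set1D hmul_set11.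
by apply: is_hypersumD IH; exact: is_hypersum1.
Qed.

End DDTheory.

Definition hypersums (F : ddHyperfield) := {A : set F | is_hypersum A}.

(* Classical decidability and choice, which the semiring structures require. *)
HB.instance Definition _ (F : ddHyperfield) := gen_eqMixin (hypersums F).
HB.instance Definition _ (F : ddHyperfield) := gen_choiceMixin (hypersums F).

Section Hypersums.
Context {F : ddHyperfield}.
Implicit Types (A B C : hypersums F).

Lemma hypersums_eq A B : sval A = sval B -> A = B.
Proof. by case: A B => A hA [B hB] /= AB; apply: eq_exist. Qed.

Definition hs_single (a : F) : hypersums F := exist _ [set a] (is_hypersum1 a).

Definition hs_add A B : hypersums F :=
  exist _ (sval A ⊕ sval B) (is_hypersumD (svalP A) (svalP B)).

Definition hs_mul A B : hypersums F :=
  exist _ (sval A ⊗ sval B) (is_hypersumM (svalP A) (svalP B)).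

Lemma hs_addA : associative hs_add.
Proof. by move=> A B C; apply: hypersums_eq; apply: hadd_setA. Qed.

Lemma hs_addC : commutative hs_add.
Proof. by move=> A B; apply: hypersums_eq; apply: hadd_setC. Qed.

Lemma hs_add0 : left_id (hs_single 0) hs_add.
Proof. by move=> A; apply: hypersums_eq; apply: hadd_set0. Qed.

Lemma hs_mulA : associative hs_mul.
Proof. by move=> A B C; apply: hypersums_eq; apply: hmul_setA. Qed.

Lemma hs_mulC : commutative hs_mul.
Proof. by move=> A B; apply: hypersums_eq; apply: hmul_setC. Qed.

Lemma hs_mul1 : left_id (hs_single 1) hs_mul.
Proof. by move=> A; apply: hypersums_eq; apply: hmul_set1. Qed.

Lemma hs_mulDl : left_distributive hs_mul hs_add.
Proof.
by move=> A B C; apply: hypersums_eq; apply: hmul_setDl; exact: svalP.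
Qed.

Lemma hs_mul0 : left_zero (hs_single 0) hs_mul.
Proof.
move=> A; apply: hypersums_eq; apply: hmul_set0.
by apply: is_hypersum_neq0; exact: svalP.
Qed.

End Hypersums.

HB.instance Definition _ (F : ddHyperfield) :=
  GRing.isNmodule.Build (hypersums F) hs_addA hs_addC (@hs_add0 F).
HB.instance Definition _ (F : ddHyperfield) :=
  GRing.Nmodule_isComPzSemiRing.Build (hypersums F)
    hs_mulA hs_mulC hs_mul1 hs_mulDl (@hs_mul0 F).

Section HypersumsTheory.
Context {F : ddHyperfield}.
Implicit Types (A B C : hypersums F) (a b c : F).

Let chg := hr_chg (hf_hyperring F).

Lemma hs_svalD A B : sval (A + B)%R = sval A ⊕ sval B. Proof. by []. Qed.
Lemma hs_svalM A B : sval (A * B)%R = sval A ⊗ sval B. Proof. by []. Qed.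

Lemma hs_singleM a b : hs_single (a * b) = (hs_single a * hs_single b)%R.
Proof. by apply: hypersums_eq; rewrite hs_svalM /= hmul_set11. Qed.

Lemma hs_sum_single (s : seq F) :
  sval (\sum_(a <- s) hs_single a)%R = hypersum s.
Proof.
elim: s => [|a s IH]; first by rewrite big_nil hypersum_nil.
by rewrite big_cons hypersum_cons -IH.
Qed.

Lemma hs_sumE A : exists s : seq F, A = (\sum_(a <- s) hs_single a)%R.
Proof.
have /is_hypersumE[s As] := svalP A; exists s.
by apply: hypersums_eq; rewrite hs_sum_single.
Qed.

Lemma hneg1M x : (hneg 1 : F) * x = - x.
Proof.
apply/(chgN chg); rewrite -{1}(hmulr1 x).
rewrite (hmulC (hneg 1)) -hmulDr.
exists 0; first exact/(chgN chg).
exact: hmulr0 x.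
Qed.

Lemma hnegK (x : F) : - (- x) = x.
Proof. by symmetry; apply/(chgN chg); rewrite (chgC chg); apply/(chgN chg). Qed.

Lemma in_hadd0 (X Y : set F) : (X ⊕ Y) 0 <-> exists2 x, X x & Y (- x).
Proof.
split=> [/in_hadd_set[x [y [Xx Yy /(chgN chg) yE]]]|[x Xx Yx]].
  by exists x => //; rewrite -yE.
by apply/in_hadd_set; exists x, (- x); split=> //; apply/(chgN chg).
Qed.

Lemma hmulN (x y : F) : x * (- y) = - (x * y).
Proof.
rewrite -(hneg1M y) hmulA.
by rewrite (hmulC x) -hmulA hneg1M.
Qed.

Lemma hs_unit A : mul_unit *%R 1%R A -> exists2 a, a <> 0 & A = hs_single a.
Proof.
move=> [B /(congr1 sval)]; rewrite hs_svalM => AB.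
have hA := is_hypersum_neq0 (svalP A); have hB := is_hypersum_neq0 (svalP B).
have {}AB x y : sval A x -> sval B y -> x * y = 1.
  move=> Ax By; have : (sval A ⊗ sval B) (x * y).
    by apply/in_hmul_set; exists x, y.
  by rewrite AB.
have [a Aa] := hA; have [b Bb] := hB.
exists a.
  move=> a0; have := AB _ _ Aa Bb; rewrite a0 hmulC.
  by rewrite hmulr0 => /esym; exact: hf_one_neq0.
apply: hypersums_eq; apply/seteqP; split=> [x Ax|_ ->] //=.
rewrite -(hmulr1 x) -(AB a b Aa Bb) (hmulC a b).
by rewrite hmulA (AB x b) // hmulC hmulr1.
Qed.

End HypersumsTheory.

Lemma Fbar_is_fuzzy (F : ddHyperfield) :
  @is_fuzzy_ring (hypersums F) *%R 1%R (hs_single (hneg 1))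
    [set A : hypersums F | sval A 0].
Proof.
split=> /=.
- exact: mulrA.
- exact: mulrC.
- exact: mul1r.
- exact: mul0r.
- by move=> a b c _; rewrite mulrDr.
- by rewrite -hs_singleM hneg1M hnegK.
- move=> A B A0 B0; apply/in_hadd_set; exists 0, 0; split=> //.
  by rewrite (chg0 (hr_chg (hf_hyperring F))).
- move=> A B B0; have [a Aa] := is_hypersum_neq0 (svalP A).
  apply/in_hmul_set; exists a, 0; split=> //.
  by rewrite hmulr0.
- by [].
- by move=> /esym; exact: hf_one_neq0.
- move=> A /hs_unit[a _ ->]; split=> [/in_hadd0[_ -> <-] //|->].
  by apply/in_hadd0; exists 1.
- move=> A B C D /in_hadd0[x Ax Bx] /in_hadd0[y Cy Dy].
  apply/in_hadd0; exists (x * y); first by apply/in_hmul_set; exists x, y.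
  apply/in_hmul_set; exists (hneg 1), (x * y); split=> //; last by rewrite hneg1M.
  apply/in_hmul_set; exists (- x), (- y); split=> //.
  by rewrite hmulN (hmulC (- x)) hmulN hnegK hmulC.
- move=> A B C D ABCD; have : sval (A + B * (C + D))%R 0 by exact: ABCD.
  by rewrite mulrDr addrA.
Qed.

Definition Fbar_ob (F : ddHyperfield) : FuzzyRing :=
  MkFuzzyRing (Fbar_is_fuzzy F).

Section Image.
Context {F G : ddHyperfield} (f : strict_hom F G).

Lemma image_hadd_set (X Y : set F) : f @` (X ⊕ Y) = f @` X ⊕ f @` Y.
Proof.
apply/seteqP; split=> w.
  move=> [z /in_hadd_set[x [y [Xx Yy xyz]]] <-]; apply/in_hadd_set.
  exists (f x), (f y); split; [by exists x | by exists y |].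
  by rewrite -shomD; exists z.
move=> /in_hadd_set[_ [_ [[x Xx <-] [y Yy <-]]]]; rewrite -shomD => -[z xyz <-].
by exists z => //; apply/in_hadd_set; exists x, y.
Qed.

Lemma image_hmul_set (X Y : set F) : f @` (X ⊗ Y) = f @` X ⊗ f @` Y.
Proof.
apply/seteqP; split=> w.
  move=> [_ /in_hmul_set[x [y [Xx Yy ->]]] <-]; apply/in_hmul_set.
  exists (f x), (f y); split; [by exists x | by exists y |].
  exact: hhomM (shom_hom f) x y.
move=> /in_hmul_set[_ [_ [[x Xx <-] [y Yy <-] ->]]].
exists (x * y); first by apply/in_hmul_set; exists x, y.
exact: hhomM (shom_hom f) x y.
Qed.

Lemma image_is_hypersum (X : set F) : is_hypersum X -> is_hypersum (f @` X).
Proof.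
move=> /is_hypersumE[s ->]; elim: s => [|a s IH].
  by rewrite hypersum_nil image_set1; exact: is_hypersum1.
rewrite hypersum_cons image_hadd_set image_set1.
by apply: is_hypersumD IH; exact: is_hypersum1.
Qed.

Definition hs_map (A : hypersums F) : hypersums G :=
  exist _ (f @` sval A) (image_is_hypersum (svalP A)).

Lemma hs_map_single a : hs_map (hs_single a) = hs_single (f a).
Proof. by apply: hypersums_eq; rewrite /= image_set1. Qed.

Lemma hs_map_nmod : nmod_morphism hs_map.
Proof.
split; first by rewrite [LHS]hs_map_single (hhom0 (shom_hom f)).
by move=> A B; apply: hypersums_eq; apply: image_hadd_set.
Qed.

Lemma hs_map_monoid : monoid_morphism hs_map.
Proof.
split; first by rewrite [LHS]hs_map_single (hhom1 (shom_hom f)).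
by move=> A B; apply: hypersums_eq; apply: image_hmul_set.
Qed.

Lemma hs_map_strong : @is_strong_morphism (Fbar_ob F) (Fbar_ob G) hs_map.
Proof.
have [f0 fD] := hs_map_nmod; have [f1 fM] := hs_map_monoid.
split; [exact: f1 | exact: f0 | by move=> A B _; exact: fM |].
move=> n a b ab0.
have <- : hs_map (\sum_(i < n) (a i * b i)%R) =
    \sum_(i < n) (hs_map (a i) * hs_map (b i))%R.
  rewrite (big_morph hs_map fD f0).
  by apply: eq_bigr => i _; apply: fM.
by exists 0 => //; exact: hhom0 (shom_hom f).
Qed.

End Image.

Lemma hs_map_id (F : ddHyperfield) : hs_map (strict_id F) =1 id.
Proof. by move=> A; apply: hypersums_eq; rewrite /= image_id. Qed.

Lemma hs_map_comp (F G H : ddHyperfield) (g : strict_hom G H)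
  (f : strict_hom F G) : hs_map (strict_comp g f) =1 hs_map g \o hs_map f.
Proof. by move=> A; apply: hypersums_eq; rewrite /= image_comp. Qed.

Definition Fbar : Functor Hyperfields_dd FuzzyRings_str.
Proof.
refine (@MkFunctor Hyperfields_dd FuzzyRings_str Fbar_ob
  (fun F G f => StrongMorphism (hs_map_strong f)) _ _).
- by move=> F; apply: strong_morphism_eq; exact: hs_map_id.
- by move=> F G H g f; apply: strong_morphism_eq; exact: hs_map_comp.
Defined.

Lemma F1_is_pd (F : ddHyperfield) : is_partial_demifield (@hs_single F).
Proof.
split.
- by move=> a b ab; have : sval (hs_single b) a by rewrite -ab.
- by [].
- exact: hs_singleM.
- move=> T [[T0 TD] _] TF A; have [s ->] := hs_sumE A.
  by apply: (big_ind (fun x => x \in T)) => // a _; exact: TF.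
- by move=> a b c /(congr1 sval); rewrite hs_svalD /= hadd_set11 => ->.
Qed.

Definition F1_ob (F : ddHyperfield) : PartialDemifield :=
  MkPartialDemifield (F1_is_pd F).

Definition F1_map (F G : ddHyperfield) (f : strict_hom F G) :
    pd_morphism (F1_ob F) (F1_ob G) :=
  @PDMorphism (F1_ob F) (F1_ob G) (hs_map f) (hs_map_nmod f) (hs_map_monoid f)
    (ex_intro2 _ _ (shom_fun f) (shom_hom f) (hs_map_single f)).

Definition F1 : Functor Hyperfields_dd PartialDemifields.
Proof.
refine (@MkFunctor Hyperfields_dd PartialDemifields F1_ob F1_map _ _).
- by move=> F; apply: (@pd_morphism_eq (F1_ob F) (F1_ob F)); exact: hs_map_id.
- move=> F G H g f; apply: (@pd_morphism_eq (F1_ob F) (F1_ob H)).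
  exact: hs_map_comp.
Defined.

(* Main.v *)
Require Import Defs.
From mathcomp Require Import all_boot all_order ssralg ssrnum rat.
From mathcomp Require Import boolp classical_sets functions.
From mathcomp Require Import lra.

(** The null set of the fuzzy ring of F, the hypersums containing 0, can be read
    off the partial demifield (F, S(F)): it consists of the sums in S of those
    finite families of elements of F whose hypersum in F contains 0.  This
    description makes sense in every partial demifield (F, S), and a morphism
    preserves it, because a hyperfield homomorphism maps a hypersum into the
    hypersum of the images.  So F_2 sends (F, S) to the semiring S with this
    null set and with eps = -1 ([F2_ob], [F2_map]).  The fuzzy ring axioms are
    transported along an isomorphism with some (X, S(X)) ([iso_F1_is_fuzzy]),
    and on the objects (F, S(F)) themselves the null set is the original one
    ([pd_null_F1]).  Hence the factorization is an equality of functors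
    ([Fbar_factor]).

    The two negative claims use the tropical hyperfields: the nonnegative
    elements of a multiplicative group with zero inside an ordered field, where
    c belongs to the hypersum of a and b when the maximum of a, b, c is attained
    at least twice.  They are doubly distributive ([trop_dd]), and their
    hypersums are the singletons {a} and the segments {x | x <= a}
    ([trop_hypersum]).  The group {0, 1} gives the Krasner hyperfield K, all
    nonnegative rationals give a hyperfield T.

    Not full ([F1_not_full]): the inclusion K -> T is not strict, because
    1 + 1 is {0, 1} in K but {x | x <= 1} in T.  It nevertheless extends to a
    semiring homomorphism S(K) -> S(T): take convex hulls, so that
    singletons go to singletons and segments to segments
    ([trop_hullD]).

    Not essentially surjective ([F1_not_ess_surjective]): the pair (K, nat) is a
    partial demifield.  If it were isomorphic to (X, S(X)), then X would only
    have the elements 0 and 1, so S(X) would have at most three elements, while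
    nat is infinite. *)

Set Implicit Arguments.
Unset Strict Implicit.
Unset Printing Implicit Defensive.

Import Order.TTheory GRing.Theory Num.Theory.

Local Open Scope classical_set_scope.
Local Open Scope ring_scope.
Local Open Scope hyper_scope.

(** * Hyperfields *)

Lemma hyperhomN (F G : Hyperfield) (g : F -> G) (a : F) :
  is_hyperhom g -> g (- a) = - g a.
Proof.
move=> [g0 _ _ gD]; apply/(chgN (hr_chg (hf_hyperring G))).
rewrite -g0; apply: gD; exists 0 => //.
exact/(chgN (hr_chg (hf_hyperring F))).
Qed.

Lemma hyperhom_hypersum (F G : Hyperfield) (g : F -> G) (s : seq F) :
  is_hyperhom g -> g @` hypersum s `<=` hypersum (map g s).
Proof.
move=> [g0 _ _ gD]; elim: s => [|a s IH] _ [x + <-] /=.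
  by rewrite !hypersum_nil => ->.
rewrite !hypersum_cons => /in_hadd_set[_ [y [-> sy axy]]].
apply/in_hadd_set; exists (g a), (g y); split=> //; first by apply: IH; exists y.
by apply: gD; exists x.
Qed.

Lemma hadd_setACA (F : Hyperfield) (A B C D : set F) :
  A ⊕ B ⊕ (C ⊕ D) = A ⊕ C ⊕ (B ⊕ D).
Proof.
by rewrite -!hadd_setA; congr (_ ⊕ _); rewrite !hadd_setA (hadd_setC B).
Qed.

(** Half of double distributivity follows from distributivity in every
    hyperfield; the other half is the real condition. *)
Lemma hmul_hadd_sub (F : Hyperfield) (a b c d : F) :
  (a ⊞ b) ⊗ (c ⊞ d) `<=`
    [set a * c] ⊕ [set a * d] ⊕ ([set b * c] ⊕ [set b * d]).
Proof.
move=> _ /in_hmul_set[x [y [abx cdy ->]]].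
have xM (z : F) : [set x * z] `<=` [set a * z] ⊕ [set b * z].
  move=> _ ->; rewrite hadd_set11 !(hmulC _ z) -hmulDr.
  by exists x => //; exact: hmulC.
rewrite hadd_setACA; apply: (hadd_setSS (xM c) (xM d)).
by rewrite hadd_set11 -hmulDr; exists y.
Qed.

(** * The factorization *)

(** The null set that F_2 attaches to P.  Pulling a null set back along a chosen
    isomorphism of P with some (X, S(X)) would hide that all morphisms
    preserve it; this description uses P alone. *)
Definition pd_null (P : PartialDemifield) : set (pd_semiring P) :=
  [set x | exists2 s : seq (pd_field P),
     x = (\sum_(a <- s) pd_incl a)%R & hypersum s 0].

Lemma pd_morphism_sum P Q (f : pd_morphism P Q) (g : pd_field P -> pd_field Q)
    (s : seq (pd_field P)) :
  (forall a, f (pd_incl a) = pd_incl (g a)) ->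
  f (\sum_(a <- s) pd_incl a)%R = (\sum_(b <- map g s) pd_incl b)%R.
Proof.
have [f0 fD] := pdm_add f; move=> fg.
by rewrite (big_morph f fD f0) big_map; apply: eq_bigr.
Qed.

Lemma pd_morphism_null P Q (f : pd_morphism P Q) x : pd_null x -> pd_null (f x).
Proof.
have [g gh fg] := pdm_restr f; move=> [s -> s0].
exists (map g s); first exact: pd_morphism_sum.
by apply: (hyperhom_hypersum gh); exists 0 => //; exact: hhom0 gh.
Qed.

Definition pd_eps (P : PartialDemifield) : pd_semiring P :=
  pd_incl (hneg 1).

Lemma pd_morphism_eps P Q (f : pd_morphism P Q) : f (pd_eps P) = pd_eps Q.
Proof.
have [g gh fg] := pdm_restr f.
by rewrite /pd_eps fg (hyperhomN _ gh) (hhom1 gh).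
Qed.

Lemma pd_null_F1 (F : ddHyperfield) (A : hypersums F) :
  @pd_null (F1_ob F) A <-> sval A 0.
Proof.
split=> [[s -> s0]|A0]; first by rewrite hs_sum_single.
by have [s As] := hs_sumE A; exists s => //; rewrite -hs_sum_single -As.
Qed.

(** By [pd_morphism_null], applied to the isomorphism and to its inverse, the
    null sets correspond; so do the elements eps, and the rest is a semiring
    isomorphism. *)
Lemma iso_F1_is_fuzzy (F : ddHyperfield) (P : PartialDemifield) :
  isomorphic (F1 F) (P : PartialDemifields) ->
  @is_fuzzy_ring (pd_semiring P) *%R 1%R (pd_eps P) (@pd_null P).
Proof.
move=> [g [f [gf fg]]].
have fK : cancel f g by move=> x; exact: (congr1 (fun h => pdm_fun h x) fg).
have f_inj := can_inj fK.
have [f0 fD] := pdm_add f; have [f1 fM] := pdm_mul f.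
have fnull x : pd_null x <-> sval (f x) 0.
  rewrite -pd_null_F1; split=> [|/(pd_morphism_null g)]; last by rewrite fK.
  exact: pd_morphism_null.
have feps : f (pd_eps P) = hs_single (hneg 1) := pd_morphism_eps f.
have funit a : mul_unit *%R 1%R a -> mul_unit *%R 1%R (f a).
  by move=> [b ab]; exists (f b); rewrite -fM ab.
have [_ mulC _ _ _ eps2 nullD nullM null0 null1 unit_eps cross distr] :=
  Fbar_is_fuzzy F.
split.
- exact: mulrA.
- by move=> x y; apply: f_inj; rewrite !fM; exact: mulC.
- exact: mul1r.
- exact: mul0r.
- by move=> a b c _; rewrite mulrDr.
- by apply: f_inj; rewrite fM f1 feps; exact: eps2.
- by move=> a b /fnull + /fnull + ; rewrite fnull fD; exact: nullD.
- by move=> a b /fnull; rewrite fnull fM; exact: nullM.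
- by rewrite fnull f0; exact: null0.
- by rewrite fnull f1; exact: null1.
- move=> a /funit ua; rewrite fnull fD f1.
  apply: (iff_trans (unit_eps _ ua)); rewrite -feps.
  by split=> [/f_inj|->].
- move=> a b c d /fnull + /fnull; rewrite !fD => ab cd.
  by apply/fnull; rewrite fD !fM feps; exact: cross.
- move=> a b c d /fnull; rewrite fD fM fD => abcd.
  by apply/fnull; rewrite !fD !fM; exact: distr.
Qed.

Lemma ess_image_is_fuzzy (Y : ess_image F1) :
  @is_fuzzy_ring (pd_semiring (sval Y)) *%R 1%R (pd_eps (sval Y))
    (@pd_null (sval Y)).
Proof. by case: (svalP Y) => F; exact: iso_F1_is_fuzzy. Qed.

Definition F2_ob (Y : ess_image F1) : FuzzyRing :=
  MkFuzzyRing (ess_image_is_fuzzy Y).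

Lemma F2_map_strong (Y Z : ess_image F1) (f : Hom Y Z) :
  @is_strong_morphism (F2_ob Y) (F2_ob Z) (pdm_fun f).
Proof.
have [f0 fD] := pdm_add f; have [f1 fM] := pdm_mul f.
split=> //; first by move=> a b _; exact: fM.
move=> n a b /(pd_morphism_null f); congr pd_null.
by rewrite (big_morph f fD f0); apply: eq_bigr => i _; exact: fM.
Qed.

Definition F2_map (Y Z : ess_image F1) (f : Hom Y Z) :
    strong_morphism (F2_ob Y) (F2_ob Z) :=
  StrongMorphism (F2_map_strong f).

Definition F2 : Functor (ess_image F1) FuzzyRings_str.
Proof.
refine (@MkFunctor (ess_image F1) FuzzyRings_str F2_ob F2_map _ _) => *;
  exact: strong_morphism_eq.
Defined.

Lemma functor_eq (C D : Category) (fo : C -> D)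
    (fm : forall X Y : C, Hom X Y -> Hom (fo X) (fo Y)) p p' q q' :
  @MkFunctor C D fo fm p q = @MkFunctor C D fo fm p' q'.
Proof. by rewrite (Prop_irrelevance p p') (Prop_irrelevance q q'). Qed.

(** The null set enters the types of the morphisms, so two functors that differ
    in it cannot be compared map by map.  Abstracting from the family of null
    sets turns the comparison into one rewriting of that family. *)
Lemma fuzzy_functor_eq
    (N N' : forall F : ddHyperfield, set (hypersums F))
    (ax : forall F, is_fuzzy_ring *%R 1%R (hs_single (hneg 1)) (N F))
    (ax' : forall F, is_fuzzy_ring *%R 1%R (hs_single (hneg 1)) (N' F))
    st st' p p' q q' :
  N = N' ->
  @MkFunctor Hyperfields_dd FuzzyRings_str (fun F => MkFuzzyRing (ax F))
    (fun F G f => @StrongMorphism (MkFuzzyRing (ax F)) (MkFuzzyRing (ax G))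
       (hs_map f) (st F G f)) p q =
  @MkFunctor Hyperfields_dd FuzzyRings_str (fun F => MkFuzzyRing (ax' F))
    (fun F G f => @StrongMorphism (MkFuzzyRing (ax' F)) (MkFuzzyRing (ax' G))
       (hs_map f) (st' F G f)) p' q'.
Proof.
move=> NN'; subst N'.
have E : ax = ax' by exact: Prop_irrelevance.
subst ax'.
have E : st = st' by exact: Prop_irrelevance.
subst st'.
exact: functor_eq.
Qed.

Lemma Fbar_factor : Fbar = fcomp F2 (corestrict F1).
Proof.
apply: (@fuzzy_functor_eq (fun F => [set A | sval A 0])
  (fun F => @pd_null (F1_ob F))).
by apply: functional_extensionality_dep => F; apply/seteqP;
  split=> A /pd_null_F1.
Qed.

(** * Tropical hyperfields *)

Local Open Scope ring_scope.

(** The possible absolute values of the elements of a field: a multiplicative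
    group together with 0, inside the nonnegative part of R. *)
Record value_group (R : realFieldType) := ValueGroup {
  vg_pred :> {pred R};
  vg0 : 0 \in vg_pred;
  vg1 : 1 \in vg_pred;
  vgM : {in vg_pred &, forall x y, x * y \in vg_pred};
  vgV : {in vg_pred, forall x, x^-1 \in vg_pred};
  vg_ge0 : {in vg_pred, forall x, 0 <= x}
}.

(** The condition on |x|, |y|, |z| that x + y + z = 0 forces for a
    non-archimedean absolute value.  Being symmetric in its arguments, it makes
    each element its own negative, and reversibility immediate. *)
Definition max_twice (R : realFieldType) (a b c : R) : bool :=
  [|| (a == b) && (c <= a), (a == c) && (b <= a) | (b == c) && (a <= b)].

Lemma max_twiceM (R : realFieldType) (t a b c : R) :
  0 < t -> max_twice (t * a) (t * b) (t * c) = max_twice a b c.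
Proof.
move=> t0; have tI := inj_eq (mulfI (lt0r_neq0 t0)).
by rewrite /max_twice !tI !ler_pM2l.
Qed.

Section Tropical.
Context {R : realFieldType} (G : value_group R).

Definition tropical := {x : R | x \in vg_pred G}.
Implicit Types (a b c d x y z : tropical).

Lemma trop_inj a b : sval a = sval b -> a = b.
Proof. exact: val_inj. Qed.

Lemma trop_ge0 a : 0 <= sval a.
Proof. exact: vg_ge0 (svalP a). Qed.

Definition trop0 : tropical := exist _ 0 (vg0 G).
Definition trop1 : tropical := exist _ 1 (vg1 G).
Definition trop_mul a b : tropical :=
  exist _ (sval a * sval b) (vgM (svalP a) (svalP b)).
Definition trop_inv a : tropical := exist _ (sval a)^-1 (vgV (svalP a)).
Definition trop_add a b : set tropical :=
  [set c | max_twice (sval a) (sval b) (sval c)].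

Lemma trop_addC a b : trop_add a b = trop_add b a.
Proof.
apply/seteqP; split=> c; rewrite /trop_add /= /max_twice; lra.
Qed.

Lemma trop_max a b : exists2 m : tropical,
  sval m = Num.max (sval a) (sval b) & trop_add a b m.
Proof.
have [ab|ba] := leP (sval a) (sval b); [exists b => // | exists a => //];
  by rewrite /trop_add /= /max_twice; lra.
Qed.

(** Both sides say that the maximum of a, b, c, w is attained at least twice.
    The intermediate v is determined by the pair (b, c), or by (a, w), unless
    both pairs are constant, and then 0 will do. *)
Lemma trop_reassoc a b c u w : trop_add a b u -> trop_add u c w ->
  exists2 v, trop_add b c v & trop_add a v w.
Proof.
move=> abu ucw; have a0 := trop_ge0 a; have b0 := trop_ge0 b.
have w0 := trop_ge0 w; move: abu ucw; rewrite /trop_add /= /max_twice.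
move=> abu ucw; case: (ltgtP (sval b) (sval c)) => bc.
- by exists c; lra.
- by exists b; lra.
case: (ltgtP (sval a) (sval w)) => aw; [exists w | exists a | exists trop0];
  rewrite /=; lra.
Qed.

Lemma trop_hypergroup : canonical_hypergroup trop_add trop0 id.
Proof.
split.
- by move=> a b; have [m _ abm] := trop_max a b; exists m.
- exact: trop_addC.
- move=> a; have a0 := trop_ge0 a; apply/seteqP; split=> x /=.
    have x0 := trop_ge0 x.
    by rewrite /trop_add /= /max_twice => h; apply: trop_inj; lra.
  by move=> ->; rewrite /trop_add /= /max_twice; lra.
- move=> a b; have a0 := trop_ge0 a; have b0 := trop_ge0 b.
  split=> [|->]; rewrite /trop_add /= /max_twice; last by lra.
  by move=> h; apply: trop_inj; lra.
- move=> a b c; rewrite /hyperop_set !bigcup_set1; apply/seteqP; split=> w.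
    move=> [u abu]; rewrite bigcup_set1 => ucw.
    by have [v bcv avw] := trop_reassoc abu ucw; exists v.
  move=> [v bcv avw].
  have cbv : trop_add c b v by rewrite trop_addC.
  have vaw : trop_add v a w by rewrite trop_addC.
  have [u bau cuw] := trop_reassoc cbv vaw.
  by exists u; rewrite ?bigcup_set1 trop_addC.
- by move=> a b c; rewrite /trop_add /= /max_twice; split; lra.
Qed.

Lemma trop_mulD a b c :
  trop_mul a @` trop_add b c = trop_add (trop_mul a b) (trop_mul a c).
Proof.
have := trop_ge0 a; rewrite le_eqVlt => /predU1P[a0|a0].
  have [m _ bcm] := trop_max b c.
  apply/seteqP; split=> [_ [x _ <-]|z].
    by rewrite /trop_add /= -a0 !mul0r /max_twice; lra.
  have z0 := trop_ge0 z; rewrite /trop_add /= -a0 !mul0r /max_twice => h.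
  by exists m => //; apply: trop_inj; rewrite /= -a0 mul0r; lra.
apply/seteqP; split=> [_ [x bcx <-]|z].
  by rewrite /trop_add /= max_twiceM.
have zE : sval z = sval a * ((sval a)^-1 * sval z).
  by rewrite mulVKf // lt0r_neq0.
rewrite /trop_add /= zE max_twiceM // => h.
by exists (trop_mul (trop_inv a) z) => //; exact: trop_inj.
Qed.

Lemma trop_hyperring : is_hyperring trop_add trop_mul trop0 trop1 id.
Proof.
split.
- exact: trop_hypergroup.
- by move=> a b c; apply: trop_inj; rewrite /= mulrA.
- by move=> a b; apply: trop_inj; rewrite /= mulrC.
- by move=> a; apply: trop_inj; rewrite /= mulr1.
- exact: trop_mulD.
- by move=> a; apply: trop_inj; rewrite /= mulr0.
Qed.

Lemma trop1_neq0 : trop1 <> trop0.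
Proof. by move=> /(congr1 sval)/eqP; rewrite /= oner_eq0. Qed.

Lemma trop_mulV a : a <> trop0 -> exists b, trop_mul a b = trop1.
Proof.
move=> a0; exists (trop_inv a); apply: trop_inj; rewrite /= divff //.
by apply/eqP => a0'; apply: a0; exact: trop_inj.
Qed.

Definition trop_hyperfield : Hyperfield :=
  MkHyperfield trop_hyperring trop1_neq0 trop_mulV.

Local Open Scope hyper_scope.

Lemma trop_addxx (a x : trop_hyperfield) : (a ⊞ a) x <-> (sval x <= sval a)%R.
Proof. rewrite /= /trop_add /= /max_twice; split; lra. Qed.

Lemma trop_add_max (a b : trop_hyperfield) : (sval a <= sval b)%R -> (a ⊞ b) b.
Proof. rewrite /= /trop_add /= /max_twice; lra. Qed.

(** Division by m, with the case m = 0 included. *)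
Lemma trop_factor (a m w : trop_hyperfield) :
  (sval w <= sval a * sval m)%R ->
  exists2 x : trop_hyperfield, (sval x <= sval a)%R & w = x * m.
Proof.
have m0 := trop_ge0 m; have w0 := trop_ge0 w.
move: m0; rewrite le_eqVlt => /predU1P[m0|m0] wam.
  exists 0; first exact: trop_ge0.
  by apply: trop_inj; rewrite /= mul0r; move: wam; rewrite -m0 mulr0; lra.
exists (trop_mul w (trop_inv m)); first by rewrite /= ler_pdivrMr.
by apply: trop_inj; rewrite /= divfK // lt0r_neq0.
Qed.

(** Every element w of the sum is at most b * d.  If a = b, the hypersum of a and
    b is a whole segment, and w is a multiple of d by an element of it;
    likewise if c = d.  If a < b and c < d, then b * d strictly dominates the
    other three products, which forces w = b * d. *)
Lemma trop_dd_ordered (a b c d : trop_hyperfield) :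
  (sval a <= sval b)%R -> (sval c <= sval d)%R ->
  [set a * c] ⊕ [set a * d] ⊕ ([set b * c] ⊕ [set b * d])
    `<=` (a ⊞ b) ⊗ (c ⊞ d).
Proof.
move=> ab cd w; rewrite hadd_setA hadd_set11.
move=> /in_hadd_set[v [_ [/in_hadd_set[u [_ [acdu -> ubcv]]] -> vbdw]]].
have a0 := trop_ge0 a; have c0 := trop_ge0 c.
have acd : (sval a * sval c <= sval a * sval d)%R by rewrite ler_wpM2l.
have acb : (sval a * sval c <= sval b * sval c)%R by rewrite ler_wpM2r.
have bcd : (sval b * sval c <= sval b * sval d)%R by rewrite ler_wpM2l; lra.
have abd : (sval a * sval d <= sval b * sval d)%R by rewrite ler_wpM2r; lra.
have wbd : (sval w <= sval b * sval d)%R.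
  by move: acdu ubcv vbdw; rewrite /= /trop_add /= /max_twice; lra.
apply/in_hmul_set.
move: ab; rewrite le_eqVlt => /predU1P[/trop_inj ab|ab].
  have [x xb ->] := trop_factor wbd; exists x, d; subst b.
  by split=> //; [exact/trop_addxx | exact: trop_add_max].
move: cd; rewrite le_eqVlt => /predU1P[/trop_inj cd|cd].
  rewrite mulrC in wbd; have [x xd ->] := trop_factor wbd.
  exists b, x; subst d; rewrite hmulC.
  by split=> //; [apply: trop_add_max; exact: ltW | exact/trop_addxx].
exists b, d; split; [exact/trop_add_max/ltW | exact/trop_add_max/ltW|].
have abd' : (sval a * sval d < sval b * sval d)%R by rewrite ltr_pM2r; lra.
have bcd' : (sval b * sval c < sval b * sval d)%R by rewrite ltr_pM2l; lra.
apply: trop_inj; move: acdu ubcv vbdw => /=.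
by rewrite /trop_add /= /max_twice; lra.
Qed.

Lemma trop_dd : doubly_distributive trop_hyperfield.
Proof.
move=> a b c d; rewrite -(hadd_set11 (a * c)) -hadd_setA.
apply/seteqP; split; first exact: hmul_hadd_sub.
have sC (x y : trop_hyperfield) : x ⊞ y = y ⊞ x := trop_addC x y.
wlog ab : a b / (sval a <= sval b)%R.
  move=> H; have [/H //|/ltW/H] := leP (sval a) (sval b).
  by rewrite hadd_setC (sC b).
wlog cd : c d / (sval c <= sval d)%R; last exact: trop_dd_ordered.
move=> H; have [/H //|/ltW/H] := leP (sval c) (sval d).
by rewrite (sC d) (hadd_setC [set a * d]) (hadd_setC [set b * d]).
Qed.

Definition trop_ddHyperfield : ddHyperfield := DDHyperfield trop_dd.

Definition down (a : trop_hyperfield) : set trop_hyperfield :=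
  [set x | (sval x <= sval a)%R].

Lemma trop_add1 (a b : trop_hyperfield) : [set a] ⊕ [set b] =
  if sval a == sval b then down a
  else if (sval a < sval b)%R then [set b] else [set a].
Proof.
rewrite hadd_set11.
case: ltgtP => ab; apply/seteqP; split=> x;
  rewrite /down /= /trop_add /= /max_twice.
- by move=> h; apply: trop_inj; lra.
- by move=> ->; lra.
- by move=> h; apply: trop_inj; lra.
- by move=> ->; lra.
- by lra.
- by lra.
Qed.

Lemma trop_add_down (a b : trop_hyperfield) : [set a] ⊕ down b =
  if (sval b < sval a)%R then [set a] else down b.
Proof.
case: ltP => ab; apply/seteqP; split=> x.
- move=> /in_hadd_set[_ [y [->]]].
  rewrite /down /= /trop_add /= /max_twice => yb h; apply: trop_inj; lra.
- move=> ->; apply/in_hadd_set; exists a, b.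
  by rewrite /down /= /trop_add /= /max_twice; split=> //; lra.
- move=> /in_hadd_set[_ [y [->]]].
  rewrite /down /= /trop_add /= /max_twice; lra.
- move=> xb; apply/in_hadd_set; move: xb; rewrite /down /= => xb.
  exists a, (if (sval a < sval x)%R then x else a).
  by case: ltP => ax; rewrite /down /= /trop_add /= /max_twice; split=> //; lra.
Qed.

(** The hypersum of a family is the singleton of its maximum when that is
    attained once, and the segment below it otherwise. *)
Lemma trop_hypersum (A : set trop_hyperfield) : is_hypersum A ->
  exists a, A = [set a] \/ A = down a.
Proof.
move=> /is_hypersumE[s ->]; elim: s => [|a s [b [|] sE]].
- by exists trop0; left; exact: hypersum_nil.
- rewrite hypersum_cons sE trop_add1.
  by case: ltgtP => _; [exists b; left | exists a; left | exists a; right].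
- rewrite hypersum_cons sE trop_add_down.
  by case: ltP => _; [exists a; left | exists b; right].
Qed.

End Tropical.

Local Open Scope hyper_scope.

(** * Morphisms between hypersum semirings *)

Section SumMap.
Context {F G : ddHyperfield} (g : F -> G) (phi : hypersums F -> hypersums G).
Context (g_hom : is_hyperhom g).
Context (phi_sum : forall s : seq F,
  phi (\sum_(a <- s) hs_single a)%R = (\sum_(a <- s) hs_single (g a))%R).

Lemma sum_map_single a : phi (hs_single a) = hs_single (g a).
Proof. by have := phi_sum [:: a]; rewrite !big_seq1. Qed.

Lemma sum_map_nmod : nmod_morphism phi.
Proof.
split; first by have := phi_sum [::]; rewrite !big_nil.
move=> A B; have [s ->] := hs_sumE A; have [t ->] := hs_sumE B.
by rewrite -big_cat /= !phi_sum big_cat.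
Qed.

Lemma sum_map_monoid : monoid_morphism phi.
Proof.
have [phi0 phiD] := sum_map_nmod.
split; first by rewrite [LHS]sum_map_single (hhom1 g_hom).
move=> A B; have [s ->] := hs_sumE A; have [t ->] := hs_sumE B.
rewrite big_distrlr /= (big_morph phi phiD phi0) !phi_sum big_distrlr /=.
apply: eq_bigr => a _; rewrite (big_morph phi phiD phi0); apply: eq_bigr => b _.
by rewrite -hs_singleM sum_map_single (hhomM g_hom) hs_singleM.
Qed.

(** Double distributivity makes the product of two hypersums the hypersum of the
    pairwise products, so the only obstruction to extending a hyperfield
    homomorphism to the hypersum semirings is well-definedness: whether
    families with equal hypersums have images with equal hypersums. *)
Definition sum_map_morphism : pd_morphism (F1_ob F) (F1_ob G) :=
  @PDMorphism (F1_ob F) (F1_ob G) phi sum_map_nmod sum_map_monoid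
    (ex_intro2 _ _ g g_hom sum_map_single).

End SumMap.

Section TropInclusion.
Context {R : realFieldType} (G H : value_group R).
Hypothesis GH : {subset vg_pred G <= vg_pred H}.

Definition trop_incl (a : trop_ddHyperfield G) : trop_ddHyperfield H :=
  exist _ (sval a) (GH (svalP a)).

(** The direct image is not enough: the image of a segment of G is a hypersum in
    H only after the elements of H in between have been added. *)
Definition trop_hull (A : set (trop_ddHyperfield G)) :
    set (trop_ddHyperfield H) :=
  [set z | exists x y, [/\ A x, A y & (sval x <= sval z <= sval y)%R]].

Lemma trop_hull1 a : trop_hull [set a] = [set trop_incl a].
Proof.
apply/seteqP; split=> [z [_ [_ [-> -> az]]]|_ ->]; last first.
  by exists a, a; rewrite /= lexx.
by apply: trop_inj; apply/eqP; rewrite eq_le andbC.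
Qed.

Lemma trop_hull_down a : trop_hull (down a) = down (trop_incl a).
Proof.
apply/seteqP; split=> z; rewrite /down /=.
  by move=> [x [y [_ ya /andP[_ zy]]]]; exact: le_trans ya.
move=> za; exists 0, a; split; [exact: (trop_ge0 a) | exact: lexx |].
by apply/andP; split=> //; exact: (trop_ge0 z).
Qed.

(** The two addition tables [trop_add1] and [trop_add_down] depend only on the
    order relations between the elements, which G and H share. *)
Lemma trop_hullD a (B : set (trop_ddHyperfield G)) : is_hypersum B ->
  trop_hull ([set a] ⊕ B) = [set trop_incl a] ⊕ trop_hull B.
Proof.
move=> /(@trop_hypersum _ G)[b [->|->]].
  rewrite trop_hull1 (trop_add1 a) (trop_add1 (trop_incl a)) /=.
  by case: ltgtP; rewrite ?trop_hull1 ?trop_hull_down.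
rewrite trop_hull_down (trop_add_down a) (trop_add_down (trop_incl a)) /=.
by case: ltP; rewrite ?trop_hull1 ?trop_hull_down.
Qed.

Lemma trop_incl_hyperhom : is_hyperhom trop_incl.
Proof.
split; try by move=> *; exact: trop_inj.
by move=> a b _ [x abx <-].
Qed.

Lemma trop_hull_hypersum s :
  trop_hull (hypersum s) = hypersum (map trop_incl s).
Proof.
elim: s => [|a s IH] /=.
  by rewrite !hypersum_nil trop_hull1 (hhom0 trop_incl_hyperhom).
rewrite !hypersum_cons trop_hullD ?IH //.
by apply/is_hypersumE; exists s.
Qed.

Lemma trop_hull_is_hypersum A : is_hypersum A -> is_hypersum (trop_hull A).
Proof.
move=> /is_hypersumE[s ->]; rewrite trop_hull_hypersum.
by apply/is_hypersumE; exists (map trop_incl s).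
Qed.

Definition hs_hull (A : hypersums (trop_ddHyperfield G)) :
    hypersums (trop_ddHyperfield H) :=
  exist _ (trop_hull (sval A)) (trop_hull_is_hypersum (svalP A)).

Lemma hs_hull_sum (s : seq (trop_ddHyperfield G)) :
  hs_hull (\sum_(a <- s) hs_single a)%R =
  (\sum_(a <- s) hs_single (trop_incl a))%R.
Proof.
apply: hypersums_eq.
rewrite -(big_map trop_incl xpredT (fun b => hs_single b)) hs_sum_single.
by rewrite -trop_hull_hypersum; exact: (congr1 trop_hull (hs_sum_single s)).
Qed.

Definition hull_morphism :
    pd_morphism (F1_ob (trop_ddHyperfield G)) (F1_ob (trop_ddHyperfield H)) :=
  sum_map_morphism trop_incl_hyperhom hs_hull_sum.

(** The segment below 1 is the hypersum 1 + 1, which a strict homomorphism maps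
    onto the hypersum 1 + 1 of the target: an inclusion can be strict only if
    the larger group adds nothing below 1. *)
Lemma hull_morphism_strict
    (f : strict_hom (trop_ddHyperfield G) (trop_ddHyperfield H)) :
  F1_map f = hull_morphism ->
  {in vg_pred H, forall z, (z <= 1)%R -> z \in vg_pred G}.
Proof.
move=> fE z Hz z1.
have imE (A : hypersums (trop_ddHyperfield G)) :
    f @` sval A = trop_hull (sval A).
  exact: (congr1 (fun h : pd_morphism (F1_ob _) (F1_ob _) => sval (h A)) fE).
have fincl a : f a = trop_incl a.
  have := imE (hs_single a); rewrite /= trop_hull1 image_set1 => E.
  by have : [set trop_incl a] (f a) by rewrite -E.
have : (f 1 ⊞ f 1) (exist _ z Hz) by rewrite fincl; exact/trop_addxx.
rewrite -shomD => -[x _]; rewrite fincl => /(congr1 sval) /= <-.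
exact: (svalP x).
Qed.

End TropInclusion.

(** * The counterexamples *)

Definition krasner_group (R : realFieldType) : value_group R.
Proof.
refine (@ValueGroup R [pred x | (x == 0) || (x == 1)]%R _ _ _ _ _).
- by rewrite inE eqxx.
- by rewrite inE eqxx orbT.
- by move=> x y /orP[]/eqP-> /orP[]/eqP->; rewrite inE ?mul0r ?mul1r eqxx ?orbT.
- by move=> x /orP[]/eqP->; rewrite inE ?invr0 ?invr1 eqxx ?orbT.
- by move=> x /orP[]/eqP->.
Defined.

Definition nonneg_group (R : realFieldType) : value_group R.
Proof.
refine (@ValueGroup R [pred x | 0 <= x]%R _ _ _ _ _).
- by rewrite inE.
- by rewrite inE.
- by move=> x y; rewrite !inE; exact: mulr_ge0.
- by move=> x; rewrite !inE invr_ge0.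
- by [].
Defined.

Lemma krasner_sub_nonneg R :
  {subset vg_pred (krasner_group R) <= vg_pred (nonneg_group R)}.
Proof. by move=> x; exact: vg_ge0. Qed.

Lemma F1_not_full : ~ full F1.
Proof.
move=> full_F1.
have [f fE] := full_F1 (trop_ddHyperfield _) (trop_ddHyperfield _)
  (hull_morphism (@krasner_sub_nonneg rat)).
(* The element 1/2 belongs to 1 + 1 in T, but not to K. *)
have := hull_morphism_strict fE.
by move=> /(_ (1 / 2%:R)%R isT isT).
Qed.

Definition krasner : Hyperfield := trop_hyperfield (krasner_group rat).

(** Since 1 + 1 = 2 is not in the image, the compatibility between the two
    additions only concerns sums with a zero term. *)
Definition krasner_nat (a : krasner) : nat := (sval a == 1)%R.

Lemma krasner_cases (a : krasner) : a = 0 \/ a = 1.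
Proof.
by case/orP: (svalP a) => /eqP a01; [left | right]; exact: trop_inj.
Qed.

Lemma krasner_nat_pd : is_partial_demifield krasner_nat.
Proof.
split.
- by move=> a b; have [->|->] := krasner_cases a; have [->|->] := krasner_cases b.
- by [].
- by move=> a b; have [->|->] := krasner_cases a; have [->|->] := krasner_cases b.
- move=> T [[T0 TD] _] TF; elim=> // n IH.
  by rewrite -addn1; apply: TD => //; exact: (TF 1).
- move=> a b c; have [->|->] := krasner_cases a; have [->|->] := krasner_cases b;
   by have [->|->] := krasner_cases c.
Qed.

Definition krasner_nat_demifield : PartialDemifield :=
  MkPartialDemifield krasner_nat_pd.

Lemma F1_not_ess_surjective : ~ ess_surjective F1.
Proof.
move=> /(_ krasner_nat_demifield)[F [f [g [gf _]]]].
have fK : cancel f g by move=> x; exact: (congr1 (fun h => pdm_fun h x) gf).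
have f_inj := can_inj fK.
have [f0 fD] := pdm_add f; have [f1 _] := pdm_mul f.
have [h _ fh] := pdm_restr f.
(* An element of F goes to 0 or 1 in nat, and so do 0 and 1 of F already. *)
have F01 (x : F) : x = 0 \/ x = 1.
  have single (y : F) : f (hs_single x) = f (hs_single y) -> x = y.
    by move=> /f_inj /(pd_inj (F1_is_pd F)).
  have := fh x; have [->|->] := krasner_cases (h x) => fx; [left | right];
    apply: single; rewrite fx; symmetry; [exact: f0 | exact: f1].
(* A hypersum that is not a singleton is therefore all of F. *)
have full_sum (A : hypersums F) : (1 < f A)%N -> sval A = setT.
  move=> fA; have A1 (y : F) : sval A <> [set y].
    move=> Ay; have AE : A = hs_single y by exact: hypersums_eq.
    by move: fA; rewrite AE [f _]fh; case: (krasner_cases (h y)) => ->.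
  have [x Ax] := is_hypersum_neq0 (svalP A).
  suff [A0 A11] : sval A 0 /\ sval A 1.
    by apply/seteqP; split=> // y _; have [->|->] := F01 y.
  split; apply: contrapT => nA.
    apply: (A1 1); apply/seteqP; split=> [y|y ->].
      by have [->|->] := F01 y.
    by move: Ax; have [->|->] := F01 x.
  apply: (A1 0); apply/seteqP; split=> [y|y ->].
    by have [->|->] := F01 y.
  by move: Ax; have [->|->] := F01 x.
have f11 : f (1 + 1)%R = 2 by rewrite fD f1.
have f111 : f (1 + 1 + 1)%R = 3 by rewrite 2!fD f1.
suff : 2 = 3 :> nat by [].
rewrite -f11 -f111; congr (f _); apply: hypersums_eq.
by rewrite !full_sum ?f11 ?f111.
Qed.

Theorem theorem6 :
  (exists F2 : Functor (ess_image F1) FuzzyRings_str,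
     Fbar = fcomp F2 (corestrict F1)) /\
  ~ full F1 /\
  ~ ess_surjective F1.
Proof.
split; first by exists F2; exact: Fbar_factor.
by split; [exact: F1_not_full | exact: F1_not_ess_surjective].
Qed.
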